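(* Let $n\in\mathbb{N}$, $n\geq 2$. Let $f\in A_n$ be such that $f=\sum_{a\in B_n}\alpha_a a$, where $\alpha_a\in\mathbb{C}$ for all $a\in B_n$. Define $$\mathcal{C}_n=\{x\in\mathcal{C} : x_k=0 \text{ for all } k\geq n\},$$ which has $2^n$ elements. For $x,y\in\mathcal{C}_n$ with $x\neq y$, denote $k_{x,y}=-\log_2\mathsf{d}_{\mathcal{C}}(x,y)$ and define $$\sigma_{x,y}=\{a\in B_n : a(x)-a(y)\neq 0\}.$$ Then $$\mathsf{L}_{\mathsf{d}_{\mathcal{C}}}(f)=\max_{x,y\in\mathcal{C}_n,\,x\neq y}\left\{2^{k_{x,y}+1}\left|\sum_{a\in\sigma_{x,y}}\pm_{a,x,y}\,\alpha_a\right|\right\},$$ where $\pm_{a,x,y}\in\{+1,-1\}$ is the sign of $a(x)-a(y)$. Moreover $\{k_{x,y} : x,y\in\mathcal{C}_n,\ x\neq y\}=\{0,\ldots,n-1\}$, and the cardinality of $\sigma_{x,y}$ is $|\sigma_{x,y}|=2^{n-1}$ for all $x,y\in\mathcal{C}_n$ with $x\neq y$.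
   Context: Convention: $\mathbb{N}$ contains $0$. The Cantor space is $\mathcal{C}=\{(x_n)_{n\in\mathbb{N}} : x_n\in\{0,1\} \text{ for all } n\}$ with the metric $\mathsf{d}_{\mathcal{C}}(x,y)=0$ if $x=y$ and $\mathsf{d}_{\mathcal{C}}(x,y)=2^{-\min\{m\in\mathbb{N} : x_m\neq y_m\}}$ otherwise. $C(\mathcal{C})$ is the C*-algebra of continuous functions $\mathcal{C}\to\mathbb{C}$ with pointwise operations, supremum norm $\|\cdot\|_\infty$ and unit $1_{C(\mathcal{C})}$ (the constant function $1$). For $n\in\mathbb{N}$, $\eta_n\in C(\mathcal{C})$ is the coordinate map $\eta_n((z_m)_{m\in\mathbb{N}})=z_n$, and $u_n=2\eta_n-1_{C(\mathcal{C})}$ (so $u_n$ takes values in $\{-1,1\}$). Set $B_0=\emptyset$ and, for $n\geq 1$, $B_n=\{\prod_{j\in F}u_j : \emptyset\neq F\subseteq\{0,\ldots,n-1\}\}$. For $n \in \mathbb{N}$ set $B_n'=\{1_{C(\mathcal{C})}\}\cup B_n$ and $A_n=\operatorname{span}_{\mathbb{C}} B_n'$; one has $|B_n'|=2^n$. The Lipschitz seminorm (with values in $[0,\infty]$) is, for $f\in C(\mathcal{C})$, $$\mathsf{L}_{\mathsf{d}_{\mathcal{C}}}(f)=\sup_{x,y\in\mathcal{C},\,x\neq y}\frac{|f(x)-f(y)|}{\mathsf{d}_{\mathcal{C}}(x,y)}.$$ *)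

(* Defs.v *)
From HB Require Import structures.
From mathcomp Require Import all_boot all_order all_algebra.
From mathcomp Require Import finmap complex.
From mathcomp Require Import all_classical all_reals all_analysis.


Import Order.TTheory GRing.Theory Num.Theory numFieldNormedType.Exports.

Local Open Scope classical_set_scope.
Local Open Scope ring_scope.

(* The Cantor space is [cantor_space], i.e. [nat -> bool] with the product
   topology; [false] and [true] stand for 0 and 1.  A function on it with
   complex values has type [cantor_space -> R[i]]; such functions form an
   algebra under the pointwise operations, whose continuous members form
   the C*-algebra of the Cantor space; [Aspan_continuous] below shows that the
   subspaces [Aspan R n] considered here consist of continuous functions. *)

Lemma cantor_neq_ex {x y : cantor_space} : x <> y -> exists m, x m != y m.
Proof.
move=> xy; apply: contrapT => /forallNP h; apply: xy.
apply: functional_extensionality_dep => m.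
by apply/eqP/negPn/negP; exact: h.
Qed.

Definition cantor_dist (R : realType) (x y : cantor_space) : R :=
  if pselect (x = y) is right xy then 2 ^- ex_minn (cantor_neq_ex xy) else 0.

Definition eta (R : realType) (n : nat) : cantor_space -> R[i] :=
  fun z => (nat_of_bool (z n))%:R.

Definition u_fun (R : realType) (n : nat) : cantor_space -> R[i] :=
  2 *: eta R n - 1.

Definition Bgen (R : realType) (n : nat) : set (cantor_space -> R[i]) :=
  [set a | exists2 F : {set 'I_n}, F != finset.set0 &
         a = \prod_(j in F) u_fun R j].

Definition Bgen1 (R : realType) (n : nat) : set (cantor_space -> R[i]) :=
  [set 1] `|` Bgen R n.

(* Sums [\sum_(a \in S)] over a classical set [S] only take into account the
   nonzero terms, and are 0 by convention when there are infinitely many. *)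
Definition lin_span {K : nzRingType} {V : lmodType K} (S : set V) : set V :=
  [set f | exists c : V -> K, f = \sum_(a \in S) c a *: a].

Definition Aspan (R : realType) (n : nat) : set (cantor_space -> R[i]) :=
  lin_span (Bgen1 R n).

Definition lip_seminorm {R : realType} (f : cantor_space -> R[i]) : \bar R :=
  ereal_sup [set r | exists x y : cantor_space, x <> y /\
    r = (Normc.normc (f x - f y) / cantor_dist R x y)%:E].

Definition cantor_trunc (n : nat) : set cantor_space :=
  [set x | forall k, (n <= k)%N -> x k = false].

Definition k_exp (R : realType) (x y : cantor_space) : R :=
  - (ln (cantor_dist R x y) / ln 2).

Definition sigma_set (R : realType) (n : nat) (x y : cantor_space) :
    set (cantor_space -> R[i]) :=
  [set a | Bgen R n a /\ a x - a y <> 0].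

Definition is_max {d} {T : porderType d} (S : set T) (m : T) : Prop :=
  S m /\ ubound S m.

Section continuity.
Variable R : realType.
Implicit Types f g : cantor_space -> R[i].

Let cont f := continuous (f : cantor_space -> R[i]^o).

Lemma cont_cst (c : R[i]) : cont (fun=> c).
Proof. by move=> x; exact: cvg_cst. Qed.

Lemma cont_mul f g : cont f -> cont g -> cont (f * g).
Proof. by move=> cf cg x; apply: (@cvgM R[i]); [exact: cf|exact: cg]. Qed.

Lemma cont_add f g : cont f -> cont g -> cont (f + g).
Proof. by move=> cf cg x; apply: (@cvgD R[i] R[i]^o); [exact: cf|exact: cg]. Qed.

Lemma cont_scale c f : cont f -> cont (c *: f).
Proof.
move=> cf; have -> : c *: f = (fun=> c) * f by apply/funext.
by apply: cont_mul; [exact: cont_cst|].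
Qed.

Lemma cont_eta n : cont (eta R n).
Proof.
move=> x; apply: (@continuous_comp cantor_space bool R[i]^o
  (fun z => z n) (fun b : bool => (nat_of_bool b)%:R)).
  exact: (@proj_continuous nat (fun=> bool) n).
by move=> U /nbhs_singleton h; rewrite /nbhs /= => y /= ->.
Qed.

Lemma cont_u n : cont (u_fun R n).
Proof.
apply: cont_add; first exact/cont_scale/cont_eta.
exact: (cont_cst (- 1)).
Qed.

Lemma cont_Bgen1 n f : Bgen1 R n f -> cont f.
Proof.
case=> [->|[F _ ->]]; first exact: (cont_cst 1).
elim/big_ind : _ => [||j _]; [exact: (cont_cst 1)|exact: cont_mul|exact: cont_u].
Qed.

Lemma Aspan_continuous n f : Aspan R n f ->
  continuous (f : cantor_space -> R[i]^o).
Proof.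
case=> c ->; rewrite big_seq.
elim/big_ind : _ => [||a]; [exact: (cont_cst 0)|exact: cont_add|].
case: finite_supportP => // X XB _ _ aX.
by apply: cont_scale; apply: (@cont_Bgen1 n); exact: XB.
Qed.
End continuity.

(* Main.v *)
(* The elements of B_n are the Walsh characters chi F, for F a nonempty subset of
   {0, ..., n-1}; they take values in {-1, 1}, so f x - f y is twice the signed
   sum of the coefficients of the characters separating x and y, and half of the
   characters separate x from y because toggling in F a coordinate where x and y
   differ toggles whether chi F x <> chi F y.  As f only depends on the first n
   coordinates, replacing x and y by their truncations changes neither f x and
   f y nor the first coordinate where they differ (when the truncations are
   distinct), so the Lipschitz seminorm is a maximum over the finite set C_n. *)

Require Import Defs.
From HB Require Import structures.
From mathcomp Require Import all_boot all_order all_algebra.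
From mathcomp Require Import finmap complex.
From mathcomp Require Import all_classical all_reals all_analysis.
From mathcomp Require Import ring.

Import Order.TTheory GRing.Theory Num.Theory numFieldNormedType.Exports.

Local Open Scope classical_set_scope.
Local Open Scope ring_scope.

(** * Sums and cardinalities over injective images *)

Lemma fsum_image (I : finType) (T : choiceType) (V : nmodType) (g : I -> T)
    (P : pred I) (G : T -> V) : injective g ->
  \sum_(a \in g @` [set` P]) G a = \sum_(i | P i) G (g i).
Proof.
move=> g_inj; rewrite -big_image.
have -> : g @` [set` P] = [set` [seq g i | i in P]].
  apply/seteqP; split => a /=; first by move=> [i Pi <-]; exact: fintype.image_f.
  by move=> /fintype.imageP[i Pi ->]; exists i.
by rewrite -fsbig_seq // map_inj_uniq ?enum_uniq.
Qed.

Lemma card_eq_image_pred (I : finType) (T : Type) (g : I -> T) (P : pred I) :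
  injective g -> (g @` [set` P] #= `I_#|P|)%card.
Proof.
move=> g_inj; apply: (card_eq_trans (inj_card_eq (in2W g_inj))).
have -> : [set` P] = [set` [fset i in P]%fset].
  by apply/seteqP; split => i; rewrite /= !inE.
by apply/card_eq_fsetP; rewrite card_finset.
Qed.

(** * Walsh characters as signs of parities *)

Definition chi (R : realType) (n : nat) (F : {set 'I_n}) :
    cantor_space -> R[i] :=
  \prod_(j in F) u_fun R j.

(* The coordinate [false] is 0, at which u takes the value -1. *)
Definition chi_odd (n : nat) (F : {set 'I_n}) (z : cantor_space) : bool :=
  \big[addb/false]_(j in F) ~~ z j.

Lemma u_funE (R : realType) (k : nat) (z : cantor_space) :
  u_fun R k z = (-1) ^+ ~~ z k.
Proof.
rewrite -[LHS]/(2 * (z k)%:R - 1 : R[i]).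
by case: (z k) => /=; rewrite ?expr0 ?expr1; ring.
Qed.

(** Signs multiply as Booleans add modulo 2, so questions about the values of characters become
    questions about parities. *)
Lemma chiE (R : realType) (n : nat) (F : {set 'I_n}) (z : cantor_space) :
  chi R n F z = (-1) ^+ chi_odd n F z.
Proof.
rewrite /chi /chi_odd fct_prodE.
rewrite (big_morph (fun b : bool => (-1) ^+ b) (@signr_addb R[i])
  (expr0 _ : (-1) ^+ false = 1)).
by apply: eq_bigr => j _; rewrite u_funE.
Qed.

Lemma chi_odd_set0 (n : nat) (z : cantor_space) : chi_odd n finset.set0 z = false.
Proof. by rewrite /chi_odd big_set0. Qed.

Lemma chi_inj (R : realType) (n : nat) : injective (chi R n).
Proof.
move=> F G FG; apply/setP => k.
(* At the point whose only zero coordinate is [k], the factor [u_fun R k] is -1 and all others are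
   1, so the value of a character there detects membership of [k]. *)
have eval (H : {set 'I_n}) : chi_odd n H (fun m => m != k :> nat) = (k \in H).
  rewrite /chi_odd; under eq_bigr => j _ do rewrite negbK.
  have [kH|kH] := boolP (k \in H).
    rewrite (bigD1 k) //= eqxx big1 // => j /andP[_ jk].
    by rewrite (inj_eq val_inj); exact: negbTE.
  rewrite big1 // => j jH; apply/negbTE; apply: contraNneq kH => jk.
  by rewrite -(val_inj jk).
rewrite -!eval; apply: (@signr_inj R[i]).
by rewrite -!chiE FG.
Qed.

(** * Counting the characters that separate two points *)

Definition toggle (n : nat) (k : 'I_n) (F : {set 'I_n}) : {set 'I_n} :=
  if k \in F then (F :\ k)%SET else (k |: F)%SET.

Lemma toggleK (n : nat) (k : 'I_n) : involutive (toggle n k).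
Proof.
move=> F; rewrite /toggle; have [kF|kF] := boolP (k \in F).
  by rewrite finset.setD11 finset.setD1K.
by rewrite finset.setU11 finset.setU1K.
Qed.

Lemma chi_odd_toggle (n : nat) (k : 'I_n) (F : {set 'I_n}) (z : cantor_space) :
  chi_odd n (toggle n k F) z = ~~ z k (+) chi_odd n F z.
Proof.
rewrite /toggle /chi_odd; have [kF|kF] := boolP (k \in F).
  by rewrite [in RHS](finset.big_setD1 k) //= addbA addbb.
by rewrite finset.big_setU1.
Qed.

Lemma card_set_ord (n : nat) : #|{: {set 'I_n}}| = (2 ^ n)%N.
Proof. by rewrite -cardsT -powersetT card_powerset cardsT card_ord. Qed.

(** Toggling [k] flips exactly one of the two parities, so it exchanges the counted family with its
    complement; each has half of the [2 ^ n] subsets. *)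
Lemma card_chi_odd_neq (n : nat) (x y : cantor_space) (k : 'I_n) :
  x k != y k ->
  #|[pred F : {set 'I_n} | chi_odd n F x != chi_odd n F y]| = (2 ^ n.-1)%N.
Proof.
move=> xyk; rewrite -cardsE; set S := finset _.
have SC : (~: S)%SET = [set toggle n k F | F in S]%SET.
  rewrite (can_imset_pre _ (toggleK n k)); apply/setP => F.
  rewrite !inE /= !chi_odd_toggle negbK.
  by move: xyk; case: (x k) (y k) (chi_odd n F x) (chi_odd n F y) => [] [] [] [].
have := cardsC S; rewrite SC (card_imset _ (inv_inj (toggleK n k))).
rewrite card_set_ord.
(* The element [k] of ['I_n] rules out [n = 0], where [n.-1] would be a default value. *)
case: n k {xyk} @S SC => [[]//|n] k S SC.
by rewrite addnn expnS mul2n => /double_inj.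
Qed.

Lemma Bgen_chi (R : realType) (n : nat) :
  Bgen R n = chi R n @` [set` [pred F | F != finset.set0]].
Proof.
apply/seteqP; split => a /=; first by move=> [F F0 ->]; exists F.
by move=> [F F0 <-]; exists F.
Qed.

Lemma sign_sub_eq0 (K : numDomainType) (a b : bool) :
  ((-1) ^+ a - (-1) ^+ b == 0 :> K) = (a == b).
Proof. by rewrite subr_eq0 (inj_eq (@signr_inj K)). Qed.

(** Nonemptiness of [F] is automatic on the right: the empty product is constant and separates no
    points. *)
Lemma sigma_set_chi (R : realType) (n : nat) (x y : cantor_space) :
  sigma_set R n x y =
  chi R n @` [set` [pred F | chi_odd n F x != chi_odd n F y]].
Proof.
rewrite /sigma_set Bgen_chi; apply/seteqP; split => a /=.
  move=> [[F F0 <-]] /eqP; rewrite !chiE sign_sub_eq0 => Fxy.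
  by exists F.
move=> [F Fxy <-]; split; last by apply/eqP; rewrite !chiE sign_sub_eq0.
exists F => //=; apply: contraNneq Fxy => ->.
by rewrite !chi_odd_set0.
Qed.

(** A character takes the values 1 and -1, so its difference is 0 or twice its sign; the common
    factor 2 comes out of the sum. *)
Lemma diff_sigma (R : realType) (n : nat) (f : cantor_space -> R[i])
    (alpha : (cantor_space -> R[i]) -> R[i]) (x y : cantor_space) :
  f = \sum_(a \in Bgen R n) alpha a *: a ->
  f x - f y = 2 * \sum_(a \in sigma_set R n x y) Num.sg (a x - a y) * alpha a.
Proof.
rewrite Bgen_chi sigma_set_chi !fsum_image; try exact: chi_inj.
move=> ->; rewrite !fct_sumE -sumrB mulr_sumr big_mkcond [RHS]big_mkcond.
apply: eq_bigr => F _ /=; rewrite !fctE !chiE -scalerBr /GRing.scale /=.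
have [->|F0] := eqVneq F finset.set0; first by rewrite !chi_odd_set0.
case: (chi_odd n F x) (chi_odd n F y) => [] [] /=; rewrite ?subrr ?mulr0 //.
  rewrite expr1 expr0 ltr0_sg; last by rewrite -opprD oppr_lt0 addr_gt0.
  by ring.
rewrite expr1 expr0 opprK gtr0_sg; last by rewrite addr_gt0.
by ring.
Qed.

(** * Points of C_n as subsets of ['I_n] *)

Definition point (n : nat) (E : {set 'I_n}) : cantor_space :=
  fun k => [exists i, (i \in E) && (i == k :> nat)].

Lemma point_ord (n : nat) (E : {set 'I_n}) (i : 'I_n) : point n E i = (i \in E).
Proof.
apply/existsP/idP => [[j /andP[jE /eqP/val_inj <-]]//|iE].
by exists i; rewrite iE eqxx.
Qed.

Lemma point_ge (n : nat) (E : {set 'I_n}) (k : nat) :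
  (n <= k)%N -> point n E k = false.
Proof.
move=> nk; apply/negbTE/existsP => -[j /andP[_ /eqP jk]].
by move: nk; rewrite -jk leqNgt ltn_ord.
Qed.

Lemma point_inj (n : nat) : injective (point n).
Proof. by move=> E E' EE'; apply/setP => i; rewrite -!point_ord EE'. Qed.

(** The truncation of [x] to its first [n] coordinates is [point n (trace n x)]. *)
Definition trace (n : nat) (x : cantor_space) : {set 'I_n} := finset (fun i : 'I_n => x i).

Lemma point_trace_lt (n : nat) (x : cantor_space) (k : nat) :
  (k < n)%N -> point n (trace n x) k = x k.
Proof. by move=> kn; rewrite (point_ord n _ (Ordinal kn)) inE. Qed.

Lemma cantor_trunc_point (n : nat) : cantor_trunc n = range (point n).
Proof.
apply/seteqP; split => [x xn|_ [E _ <-] k]; last exact: point_ge.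
exists (trace n x) => //; apply/funext => k.
have [nk|kn] := leqP n k; first by rewrite point_ge // xn.
exact: point_trace_lt.
Qed.

(** * Distances and difference quotients *)

Lemma neq_first (x y : cantor_space) : x <> y ->
  exists2 m, x m != y m & forall k, x k != y k -> (m <= k)%N.
Proof. by move=> xy; case: (ex_minnP (cantor_neq_ex xy)) => m; exists m. Qed.

(** Uniqueness of the minimum replaces the [ex_minn] term, which carries a proof of [x <> y], by any
    known first index of disagreement. *)
Lemma cantor_distE (R : realType) (x y : cantor_space) (m : nat) :
  x m != y m -> (forall k, x k != y k -> (m <= k)%N) ->
  cantor_dist R x y = 2 ^- m.
Proof.
rewrite /cantor_dist; case: pselect => [->|xy xym m_min]; first by rewrite eqxx.
case: ex_minnP => k xyk k_min; congr (2 ^- _).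
by apply/eqP; rewrite eqn_leq k_min ?m_min.
Qed.

Lemma k_expE (R : realType) (x y : cantor_space) (m : nat) :
  cantor_dist R x y = 2 ^- m -> k_exp R x y = m%:R.
Proof.
move=> xy; rewrite /k_exp xy lnV ?posrE ?exprn_gt0 // lnXn // mulNr opprK.
by rewrite mulrnAl divff // gt_eqF // ln_gt0 // ltr1n.
Qed.

Definition slope (R : realType) (f : cantor_space -> R[i])
    (x y : cantor_space) : R :=
  Normc.normc (f x - f y) / cantor_dist R x y.

(** Dividing by the distance [2 ^- m] gives the factor [2 ^ m]; the extra 1 in the exponent is the
    factor 2 of [diff_sigma]. *)
Lemma slope_sigma (R : realType) (n : nat) (f : cantor_space -> R[i])
    (alpha : (cantor_space -> R[i]) -> R[i]) (x y : cantor_space) :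
  f = \sum_(a \in Bgen R n) alpha a *: a -> x <> y ->
  2 `^ (k_exp R x y + 1) *
    Normc.normc (\sum_(a \in sigma_set R n x y) Num.sg (a x - a y) * alpha a) =
  slope R f x y.
Proof.
move=> f_eq /neq_first[m xym m_min]; rewrite /slope (diff_sigma R n f alpha) //.
have xyE := cantor_distE R x y m xym m_min.
rewrite (k_expE R x y m xyE) xyE invrK natr1 powR_mulrn // Normc.normcM.
have -> : Normc.normc (2 : R[i]) = 2.
  by rewrite (normcMn 1 2) Normc.normc1.
by rewrite exprSr; ring.
Qed.

Lemma eq_head_value (R : realType) (n : nat) (f : cantor_space -> R[i])
    (alpha : (cantor_space -> R[i]) -> R[i]) (x y : cantor_space) :
  f = \sum_(a \in Bgen R n) alpha a *: a ->
  (forall k, (k < n)%N -> x k = y k) -> f x = f y.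
Proof.
rewrite Bgen_chi fsum_image; last exact: chi_inj.
move=> -> xy; rewrite !fct_sumE; apply: eq_bigr => F _.
rewrite !fctE !chiE /chi_odd; congr (_ *: (-1) ^+ nat_of_bool _).
by apply: eq_bigr => j _; rewrite xy.
Qed.

Lemma slope_trace (R : realType) (n : nat) (f : cantor_space -> R[i])
    (alpha : (cantor_space -> R[i]) -> R[i]) (x y : cantor_space) :
  f = \sum_(a \in Bgen R n) alpha a *: a -> trace n x != trace n y ->
  slope R f x y = slope R f (point n (trace n x)) (point n (trace n y)).
Proof.
move=> f_eq xy.
have head z : f (point n (trace n z)) = f z.
  by apply: (eq_head_value R n f alpha) => // k; exact: point_trace_lt.
rewrite /slope !head; congr (_ / _).
have /neq_first[m pm m_min] : point n (trace n x) <> point n (trace n y).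
  by move/point_inj/eqP; rewrite (negbTE xy).
(* Both truncations vanish from [n] on, so they first differ below [n], where they agree with [x]
   and [y]. *)
have mn : (m < n)%N by rewrite ltnNge; apply: contraNN pm => nm; rewrite !point_ge.
rewrite (cantor_distE R _ _ m pm m_min); apply: cantor_distE.
  by move: pm; rewrite !point_trace_lt.
move=> k xyk; have [nk|kn] := leqP n k; first exact: leq_trans (ltnW mn) nk.
by apply: m_min; rewrite !point_trace_lt.
Qed.

Theorem theorem2p6 (R : realType) (n : nat) (f : cantor_space -> R[i])
    (alpha : (cantor_space -> R[i]) -> R[i])
    (n_ge2 : (2 <= n)%N)
    (fA : Aspan R n f)
    (f_eq : f = \sum_(a \in Bgen R n) alpha a *: a) :
  [/\ (cantor_trunc n #= `I_(2 ^ n)%N)%card,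
      is_max
        [set r : \bar R | exists x y : cantor_space,
          [/\ cantor_trunc n x, cantor_trunc n y, x <> y &
            r = (2 `^ (k_exp R x y + 1) *
                 Normc.normc (\sum_(a \in sigma_set R n x y)
                                Num.sg (a x - a y) * alpha a))%:E]]
        (lip_seminorm f),
      [set k : R | exists x y : cantor_space,
        [/\ cantor_trunc n x, cantor_trunc n y, x <> y & k = k_exp R x y]] =
      [set i%:R | i in `I_n] &
      forall x y : cantor_space,
        cantor_trunc n x -> cantor_trunc n y -> x <> y ->
        (sigma_set R n x y #= `I_(2 ^ n.-1)%N)%card].
Proof.
have slopeE := slope_sigma R n f alpha _ _ f_eq.
split.
- rewrite cantor_trunc_point.
  have := card_eq_image_pred _ _ (point n) predT (@point_inj n).
  rewrite card_set_ord.
  by have -> : [set` predT] = [set: {set 'I_n}] by apply/seteqP; split.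
- pose distinct (p : {set 'I_n} * {set 'I_n}) := p.1 != p.2.
  pose slope_at (p : {set 'I_n} * {set 'I_n}) := slope R f (point n p.1) (point n p.2).
  (* A maximum over distinct pairs needs one such pair to start from; ['I_n] is nonempty by
     [n_ge2]. *)
  have p0 : distinct (finset.set0, finset.setT).
    rewrite /distinct eq_sym -card_gt0 cardsT card_ord.
    exact: ltnW.
  have [p p_neq p_max] := arg_maxP slope_at p0.
  have p_pt : point n p.1 <> point n p.2.
    by move/point_inj/eqP; exact/negP.
  have -> : lip_seminorm f = (slope_at p)%:E.
    apply/eqP; rewrite eq_le; apply/andP; split.
      apply: ge_ereal_sup => _ [x [y [xy ->]]]; rewrite lee_fin -/(slope R f x y).
      have [xyn|xyn] := eqVneq (trace n x) (trace n y); last first.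
        by rewrite (slope_trace R n f alpha) //; exact: (p_max (_, _)).
      (* Points with equal truncations get the same value of [f]; their zero quotient lies below the
         maximum, which is nonnegative. *)
      have -> : slope R f x y = 0.
        rewrite /slope (eq_head_value R n f alpha x y) //.
          by rewrite subrr Normc.normc0 mul0r.
        by move=> k kn; rewrite -(point_trace_lt n x k kn) xyn point_trace_lt.
      rewrite /slope_at /slope divr_ge0 //; first by case: (_ - _) => a b; exact: sqrtr_ge0.
      by have [m pm m_min] := neq_first _ _ p_pt; rewrite (cantor_distE R _ _ m).
    apply: ereal_sup_ubound; by exists (point n p.1), (point n p.2).
  split.
    exists (point n p.1), (point n p.2); rewrite cantor_trunc_point.
    by split=> //; rewrite slopeE.
  move=> _ [x [y [+ + xy ->]]]; rewrite cantor_trunc_point.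
  move=> [E _ xE] [E' _ yE]; subst; rewrite slopeE // lee_fin.
  by apply: (p_max (E, E')); apply/eqP => /= EE'; apply: xy; rewrite EE'.
- apply/seteqP; split => [_ [x [y [xn yn xy ->]]]|_ [m /= mn <-]].
    have [m xym m_min] := neq_first x y xy.
    exists m => /=; last by rewrite (k_expE R x y m) //; exact: cantor_distE.
    by rewrite ltnNge; apply: contraNN xym => nm; rewrite xn ?yn.
  (* The zero sequence and the indicator of [m] differ at [m] only, so their distance is
     [2 ^- m]. *)
  exists (point n finset.set0), (point n [set Ordinal mn]%SET).
  rewrite cantor_trunc_point.
  have dist_m k : point n finset.set0 k != point n [set Ordinal mn]%SET k -> k = m.
    have [nk|kn] := leqP n k; first by rewrite !point_ge.
    rewrite !(point_ord n _ (Ordinal kn)) !inE.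
    by case: (Ordinal kn =P Ordinal mn) => [[]|].
  have pm : point n finset.set0 m != point n [set Ordinal mn]%SET m.
    by rewrite !(point_ord n _ (Ordinal mn)) !inE eqxx.
  split=> //; first by move=> e; rewrite e eqxx in pm.
  rewrite (k_expE R _ _ m) //; apply: cantor_distE => // k /dist_m ->.
  exact: leqnn.
- move=> x y xn yn xy; rewrite sigma_set_chi.
  (* Any coordinate below [n] where [x] and [y] differ can be toggled; the first difference is
     one. *)
  have [m xym _] := neq_first x y xy.
  have mn : (m < n)%N.
    by rewrite ltnNge; apply: contraNN xym => nm; rewrite xn ?yn.
  rewrite -(card_chi_odd_neq n x y (Ordinal mn)) //.
  exact: card_eq_image_pred (@chi_inj R n).
Qed.
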